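(* There are finite languages $L_1, L_2$ with regular expressions of length $O(n)$ such that (a) $\mathrm{rpn}(L_1 \cap L_2) \geq n^{\Omega(\log n)}$, (b) $\mathrm{rpn}(\operatorname{shuffle}(L_1, L_2)) \geq n^{\Omega(\log n)}$. There is a regular language $L \subseteq \Sigma^*$ with regular expressions of length $O(n)$, such that (c) $\mathrm{rpn}(L \cap \Sigma^n) \geq n^{\Omega(\log n)}$.
   Context: Regular expressions are built from $\emptyset$, $\epsilon$, letters of an alphabet $\Sigma$, union $(+)$, concatenation $(\cdot)$ and star $(^* )$. The length $\mathrm{rpn}(R)$ of an expression $R$ is its reverse polish length, i.e., the number of nodes in its syntax tree; for a regular language $L$, $\mathrm{rpn}(L)$ is the length of a shortest expression describing $L$. The shuffle (interleaving) of two words $v,w$ is the set of all words of the form $v_1 w_1 v_2 w_2 \cdots v_k w_k$ with $k\in\mathbb{N}$, $v_i,w_i\in\Sigma^*$, $v_1\cdots v_k = v$ and $w_1\cdots w_k = w$; the shuffle of two languages is $\operatorname{shuffle}(L_1,L_2)=\bigcup_{v\in L_1, w\in L_2}\operatorname{shuffle}(v,w)$. *)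

(* Defs.v *)
From mathcomp Require Import all_boot.
From Stdlib Require Import Reals.

Set Implicit Arguments.
Unset Strict Implicit.
Unset Printing Implicit Defensive.

Definition lang (A : Type) := seq A -> Prop.

Inductive regex (A : Type) : Type :=
| REmpty : regex A
| REps : regex A
| RLit : A -> regex A
| RPlus : regex A -> regex A -> regex A
| RCat : regex A -> regex A -> regex A
| RStar : regex A -> regex A.

Arguments REmpty {A}.
Arguments REps {A}.

(* reverse polish length = number of nodes of the syntax tree *)
Fixpoint rpn_size (A : Type) (r : regex A) : nat :=
  match r with
  | REmpty | REps | RLit _ => 1
  | RPlus r1 r2 | RCat r1 r2 => (rpn_size r1 + rpn_size r2).+1
  | RStar r1 => (rpn_size r1).+1
  end.

Fixpoint regex_lang (A : Type) (r : regex A) : lang A :=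
  match r with
  | REmpty => fun _ => False
  | REps => fun w => w = [::]
  | RLit a => fun w => w = [:: a]
  | RPlus r1 r2 => fun w => regex_lang r1 w \/ regex_lang r2 w
  | RCat r1 r2 => fun w => exists u v, w = u ++ v /\ regex_lang r1 u /\ regex_lang r2 v
  | RStar r1 => fun w => exists ws : seq (seq A),
                  w = flatten ws /\ (forall u, List.In u ws -> regex_lang r1 u)
  end.

Definition describes (A : Type) (r : regex A) (L : lang A) : Prop :=
  forall w, regex_lang r w <-> L w.

Definition rpn_ge (A : Type) (L : lang A) (b : R) : Prop :=
  forall r : regex A, describes r L -> (b <= INR (rpn_size r))%R.

Definition finite_lang (A : Type) (L : lang A) : Prop :=
  exists ws : seq (seq A), forall w, L w <-> List.In w ws.

Definition lang_inter (A : Type) (L1 L2 : lang A) : lang A :=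
  fun w => L1 w /\ L2 w.

Definition shuffle_words (A : Type) (v w u : seq A) : Prop :=
  exists vs ws : seq (seq A),
    size vs = size ws /\ flatten vs = v /\ flatten ws = w /\
    u = flatten [seq p.1 ++ p.2 | p <- zip vs ws].

Definition shuffle (A : Type) (L1 L2 : lang A) : lang A :=
  fun u => exists v w, L1 v /\ L2 w /\ shuffle_words v w u.

Definition restrict_len (A : Type) (L : lang A) (n : nat) : lang A :=
  fun w => L w /\ size w = n.

Definition superpoly_bound (c : R) (n : nat) : R :=
  Rpower (INR n) (c * ln (INR n)).

(* Main.v *)
Require Import Defs.
From mathcomp Require Import all_boot zify.
From Stdlib Require Import Reals Lra.
(* [Reals] rebinds [^] in [nat_scope] to [Nat.pow]. *)
Import ssrnat.

Set Implicit Arguments.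
Unset Strict Implicit.
Unset Printing Implicit Defensive.

(** The hard languages are slices of the Boolean cube: the words of length [n]
    with exactly [k] ones. In an expression for a slice every useful
    subexpression describes words of a common length [m] and a common number
    of ones. By induction it describes at most [rpn * 2 ^ m / gain m] words,
    where [gain m = exp (ln (m + 1) ^ 2 / 8)]: unions are additive, and in a
    concatenation the factor of smaller length [m1] has at most
    ['C(m1, k1) <= 2 ^ m1 / sqrt (m1 + 1)] words, a saving that pays for the
    growth of [gain] from [m2] to [m1 + m2]. Some slice contains at least
    [2 ^ n / (n + 1)] words, so its expressions have size at least
    [gain n / (n + 1)].

    Shuffling [1^k] with [0^(n - k)] gives a slice, and so does cutting out
    the words of length [n] with exactly [k] ones described by [0*10*1...0*].
    Erasing a letter, or forbidding it, does not change the size of an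
    expression; so the slice is also reached from the encoding of [0] by [0]
    and of [1] by [1c], where [n] encoded letters have total length [n + k]
    exactly when [k] of them are ones, which is an intersection. *)

(** * Binomial bounds and the number of words in a slice *)

(** The squared form stays in [nat] and suits induction: away from the centre one step of
    [mul_bin_diag] costs at most a factor 4, up to the symmetry of [k] and [n - k]. *)
Lemma bin_sqr_le (n k : nat) : 'C(n, k) ^ 2 * n.+1 <= 4 ^ n.
Proof.
elim/ltn_ind: n k => -[|n] IHn k; first by case: k.
have large (j : nat) : n.+2 <= j.*2 -> 'C(n.+1, j) ^ 2 * n.+2 <= 4 ^ n.+1.
  case: j => // j n_le; have IH := IHn n (leqnn _) j.
  have /= diag := mul_bin_diag n.+1 j.
  rewrite -(@leq_pmul2l (j.+1 ^ 2)) ?expn_gt0 //.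
  have -> : j.+1 ^ 2 * ('C(n.+1, j.+1) ^ 2 * n.+2) =
      n.+1 * n.+2 * ('C(n, j) ^ 2 * n.+1).
    transitivity ((j.+1 * 'C(n.+1, j.+1)) ^ 2 * n.+2); first by lia.
    by rewrite -diag; lia.
  have -> : j.+1 ^ 2 * 4 ^ n.+1 = 4 * j.+1 ^ 2 * 4 ^ n by rewrite (expnS 4) mulnCA mulnA.
  by apply: leq_mul => //; nia.
have [/large //|k_lt] := leqP n.+2 k.*2.
have [k_gt|k_le] := ltnP n.+1 k; first by rewrite bin_small.
have [/large|k_ge] := leqP n.+2 (n.+1 - k).*2; first by rewrite bin_sub.
(* Neither [k] nor its mirror image lies past the middle, so [n.+1] is twice [k]. This central
   coefficient is reduced to ['C(j.*2, j)], two rows up, at a cost of at most 16. *)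
have [j -> nE] : exists2 j, k = j.+1 & n = j.*2.+1 by exists k.-1; lia.
have binE : j.+1 * 'C(n, j) = n * 'C(j.*2, j).
  have -> : 'C(n, j) = 'C(n, j.+1) by rewrite -bin_sub; [congr 'C(_, _)|]; lia.
  by rewrite nE -mul_bin_diag.
have binSE : 'C(n.+1, j.+1) = 2 * 'C(n, j).
  have <- : 'C(n, j.+1) = 'C(n, j) by rewrite -bin_sub; [congr 'C(_, _)|]; lia.
  rewrite binS mul2n -addnn; congr (_ + _).
  by rewrite -bin_sub; [congr 'C(_, _)|]; lia.
have IH := IHn j.*2 ltac:(lia) j; rewrite binSE.
rewrite -(@leq_pmul2l (j.+1 ^ 2)) ?expn_gt0 //.
have -> : j.+1 ^ 2 * ((2 * 'C(n, j)) ^ 2 * n.+2) =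
    4 * n.+2 * (j.+1 * 'C(n, j)) ^ 2 by nia.
have -> : 4 * n.+2 * (j.+1 * 'C(n, j)) ^ 2 =
    4 * n * n.+2 * ('C(j.*2, j) ^ 2 * j.*2.+1) by rewrite binE nE; nia.
have -> : j.+1 ^ 2 * 4 ^ n.+1 = 16 * j.+1 ^ 2 * 4 ^ j.*2.
  by rewrite nE 2!(expnS 4) (mulnA 4) mulnCA mulnA.
by apply: leq_mul; nia.
Qed.

Lemma size_count_le_bin (m k : nat) (ws : seq (seq bool)) :
  uniq ws -> (forall w, w \in ws -> size w = m /\ count_mem true w = k) ->
  size ws <= 'C(m, k).
Proof.
elim: m k ws => [|m IHm] k ws ws_uniq ws_in.
  have ws_sub : {subset ws <= [:: [::]]}.
    by move=> w /ws_in[/size0nil -> _]; rewrite inE.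
  case: k ws_in => [|k] ws_in; first exact: uniq_leq_size ws_sub.
  case: ws ws_in {ws_uniq ws_sub} => [//|w ws] ws_in.
  by have [/size0nil ->] := ws_in w (mem_head _ _).
(* Pascal's rule as a partition by first letter; the words are nonempty, so [behead] is injective on
   each part. *)
pose part b := map behead [seq w <- ws | head false w == b].
have part_uniq b : uniq (part b).
  rewrite map_inj_in_uniq ?filter_uniq // => u v.
  rewrite !mem_filter => /andP[/eqP u_head /ws_in[u_size _]].
  move=> /andP[/eqP v_head /ws_in[v_size _]].
  by case: u v u_head v_head u_size v_size => [|a u] [|c v] //= -> -> _ _ ->.
have part_in b w : w \in part b -> size w = m /\ b + count_mem true w = k.
  case/mapP=> u; rewrite mem_filter => /andP[/eqP u_head /ws_in[u_size u_count]] ->.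
  by case: u u_head u_size u_count => //= a u -> [->]; rewrite eqb_id.
have -> : size ws = size (part true) + size (part false).
  rewrite !size_map !size_filter -(count_predC (fun w => head false w == true)).
  congr (_ + _).
  by apply: eq_count => w /=; case: (head _ _).
have false_le : size (part false) <= 'C(m, k).
  by apply: IHm => // w /part_in[-> /=]; lia.
case: k {ws_in} part_in false_le => [|k] part_in false_le.
  case: (part true) (part_in true) => [_|w s true_in].
    by rewrite add0n bin0 -(bin0 m).
  by have [] := true_in w (mem_head _ _).
rewrite binS addnC leq_add //; apply: IHm => // w /part_in[-> /=]; lia.
Qed.

Lemma bin_sqrt_le (m k : nat) :
  (INR 'C(m, k) * sqrt (INR m.+1) <= 2 ^ m)%R.
Proof.
apply: Rsqr_incr_0_var; last by apply: pow_le; lra.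
rewrite Rsqr_mult Rsqr_sqrt; last exact: pos_INR.
have /leP/le_INR := bin_sqr_le m k.
have <- : INR ('C(m, k) ^ 2 * m.+1) = (Rsqr (INR 'C(m, k)) * INR m.+1)%R.
  by rewrite expnS expn1 !mult_INR.
suff -> : INR (4 ^ m) = Rsqr (2 ^ m) by [].
rewrite /Rsqr -Rpow_mult_distr; elim: m => //= m IHm.
by rewrite expnS mult_INR IHm /=; congr Rmult; ring.
Qed.

(** * Logarithmic inequalities and the growth of [gain] *)

Lemma ln_le_sub1 (x : R) : (0 < x -> ln x <= x - 1)%R.
Proof. by move=> x_gt0; have := exp_ineq1_le (ln x); rewrite exp_ln //; lra. Qed.

Lemma exp_le_compat (x y : R) : (x <= y -> exp x <= exp y)%R.
Proof. by case=> [/exp_increasing/Rlt_le|->] //; apply: Rle_refl. Qed.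

Lemma ln_le_compat (x y : R) : (0 < x -> x <= y -> ln x <= ln y)%R.
Proof.
move=> x_gt0; case=> [/(ln_increasing _ _ x_gt0)/Rlt_le|->] //.
exact: Rle_refl.
Qed.

(* Concavity of [ln] at [z], a convex combination of [1] and [1 + y], from
   the tangent line at [z]. *)
Lemma ln_concave (x y : R) :
  (0 <= x <= y -> x / (1 + y) * ln (1 + y) <= ln (1 + x))%R.
Proof.
move=> xy; set t := (x / (1 + y))%R; set z := (1 + t * y)%R.
have t_ge0 : (0 <= t)%R by apply: Rle_mult_inv_pos; lra.
have ty : (t * (1 + y) = x)%R by rewrite /t; field; lra.
have t_le1 : (t <= 1)%R by nra.
have z_gt0 : (0 < z)%R by rewrite /z; nra.
have zx : (z <= 1 + x)%R by rewrite /z; nra.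
have := ln_le_compat z_gt0 zx.
have tangent (u : R) : (0 < u -> ln u <= ln z + (u / z - 1))%R.
  move=> u_gt0; have -> : ln u = (ln z + ln (u / z))%R.
    by rewrite -ln_mult //; [congr ln; field; lra | apply: Rdiv_lt_0_compat].
  by have := ln_le_sub1 (Rdiv_lt_0_compat _ _ u_gt0 z_gt0); lra.
have := tangent (1 + y)%R ltac:(lra); have := tangent 1%R ltac:(lra).
rewrite ln_1 => H1 H2 H3.
have : (t * ((1 + y) / z - 1) + (1 - t) * (1 / z - 1) = 0)%R.
  by rewrite /z; field; rewrite -/z; lra.
nra.
Qed.

Definition gain (m : nat) : R := exp (ln (INR m.+1) ^ 2 / 8).

Lemma gain_gt0 (m : nat) : (0 < gain m)%R.
Proof. exact: exp_pos. Qed.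

(** With [a = ln (1 + y)] and [b = ln (1 + x + y)] the claim is [b^2 - a^2 <= 4 ln (1 + x)]. Here
    [b - a <= x / (1 + y)] and [b + a <= 3a], and concavity bounds [x / (1 + y) * a] by
    [ln (1 + x)]. The divisor 8 in [gain] leaves some slack. *)
Lemma gain_add (m1 m2 : nat) :
  (m1 <= m2)%N -> (gain (m1 + m2) <= sqrt (INR m1.+1) * gain m2)%R.
Proof.
move=> /leP/le_INR m12.
have S_INR_comm m : INR m.+1 = (1 + INR m)%R by rewrite S_INR; lra.
have m1_ge0 := pos_INR m1.
have -> : sqrt (INR m1.+1) = exp (ln (INR m1.+1) / 2).
  have m1_gt0 : (0 < INR m1.+1)%R by rewrite S_INR_comm; lra.
  have sqrt_gt0 := sqrt_lt_R0 _ m1_gt0.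
  rewrite -{2}(sqrt_sqrt (INR m1.+1)) ?ln_mult //; last by lra.
  rewrite -[LHS]exp_ln //; congr exp; field.
rewrite /gain -exp_plus; apply: exp_le_compat; rewrite !S_INR_comm plus_INR.
move: (INR m1) (INR m2) m12 m1_ge0 => x y xy x_ge0 {m1 m2 S_INR_comm}.
have concave := ln_concave (conj x_ge0 xy).
have y1_gt0 : (0 < 1 + y)%R by lra.
set a := ln (1 + y) in concave *; set b := ln (1 + (x + y)).
have a_ge0 : (0 <= a)%R.
  by rewrite -ln_1; apply: ln_le_compat; lra.
have ratioE : b = (a + ln ((1 + (x + y)) / (1 + y)))%R.
  rewrite -ln_mult //; last by apply: Rdiv_lt_0_compat; lra.
  by congr ln; field; lra.
have ba : (b - a <= x / (1 + y))%R.
  have := @ln_le_sub1 ((1 + (x + y)) / (1 + y))%R.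
  have -> : ((1 + (x + y)) / (1 + y) - 1 = x / (1 + y))%R by field; lra.
  by rewrite ratioE => /(_ ltac:(apply: Rdiv_lt_0_compat; lra)); lra.
have b2a : (b <= 2 * a)%R.
  have -> : (2 * a = ln ((1 + y) * (1 + y)))%R by rewrite ln_mult // -/a; lra.
  by apply: ln_le_compat; nra.
have t_ge0 : (0 <= x / (1 + y))%R by apply: Rle_mult_inv_pos.
have : (0 <= b)%R by rewrite /b -ln_1; apply: ln_le_compat; lra.
nra.
Qed.

(** * Counting words of expressions inside a slice *)

Definition slice (n k : nat) : lang bool :=
  fun w => size w = n /\ count_mem true w = k.

(** All words share one Parikh vector; the empty language satisfies this for every [m] and [k]. *)
Definition parikh (L : lang bool) (m k : nat) : Prop :=
  forall w, L w -> slice m k w.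

(** [P] and [Q] are not Boolean, so the list cannot be filtered; it is divided element by
    element. *)
Lemma split_or (T : eqType) (P Q : T -> Prop) (s : seq T) :
  (forall x, x \in s -> P x \/ Q x) ->
  exists s1 s2, [/\ perm_eq s (s1 ++ s2), forall x, x \in s1 -> P x
    & forall x, x \in s2 -> Q x].
Proof.
elim: s => [_|x s IHs s_PQ]; first by exists [::], [::].
have [y ys|s1 [s2 [s_perm s1_P s2_Q]]] := IHs.
  by apply: s_PQ; rewrite inE ys orbT.
have [Px|Qx] := s_PQ x (mem_head _ _).
  exists (x :: s1), s2; split=> //=; first by rewrite perm_cons.
  by move=> y; rewrite inE => /predU1P[->|/s1_P].
exists s1, (x :: s2); split=> //.
  by rewrite perm_sym perm_catC /= perm_cons perm_catC perm_sym.
by move=> y; rewrite inE => /predU1P[->|/s2_Q].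
Qed.

(** The cut position is fixed, so a word is determined by its two pieces. *)
Lemma size_le_take_drop (T : eqType) (m : nat) (s : seq (seq T)) :
  uniq s ->
  size s <= size (undup (map (take m) s)) * size (undup (map (drop m) s)).
Proof.
move=> s_uniq; set s1 := undup _; set s2 := undup _.
rewrite -(size_map (fun w => (take m w, drop m w))) -(size_allpairs pair).
apply: uniq_leq_size.
  rewrite map_inj_in_uniq // => u v _ _ [uv1 uv2].
  by rewrite -(cat_take_drop m u) uv1 uv2 cat_take_drop.
move=> _ /mapP[w w_s ->]; apply: allpairs_f; rewrite mem_undup.
  by apply/mapP; exists w.
by apply/mapP; exists w.
Qed.

Lemma rpn_size_gt0 (A : Type) (r : regex A) : 0 < rpn_size r.
Proof. by case: r. Qed.

Lemma gain_le_pow (m : nat) : m <= 1 -> (gain m <= 2 ^ m)%R.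
Proof.
case: m => [_|[_|//]].
  by rewrite /gain /= ln_1 !Rmult_0_l /Rdiv Rmult_0_l exp_0; lra.
have ln2_le : (ln 2 <= 1)%R by have := @ln_le_sub1 2; lra.
have ln2_ge : (0 <= ln 2)%R by rewrite -ln_1; apply: ln_le_compat; lra.
rewrite -[(2 ^ 1)%R]exp_ln; last by lra.
by apply: exp_le_compat; rewrite (_ : INR 2 = 2%R) // pow_1; nra.
Qed.

(** Base case of the induction: such a slice has at most one word, which the positive size of any
    expression pays for. *)
Lemma short_parikh_bound (A : Type) (r : regex A) (m k : nat) (ws : seq (seq bool)) :
  m <= 1 -> uniq ws ->
  (forall w, w \in ws -> size w = m /\ count_mem true w = k) ->
  (INR (size ws) * gain m <= INR (rpn_size r) * 2 ^ m)%R.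
Proof.
move=> m_le1 ws_uniq ws_in.
have ws_le1 : (size ws <= 1)%N.
  apply: leq_trans (size_count_le_bin ws_uniq ws_in) _.
  by case: m m_le1 {ws_in} => [|[|//]] _; case: k => [|[|[]]].
apply: Rmult_le_compat; [exact: pos_INR | exact/Rlt_le/gain_gt0 | | exact: gain_le_pow].
by apply/le_INR/leP; apply: leq_trans ws_le1 (rpn_size_gt0 r).
Qed.

(* The factor with the shorter words is estimated by the binomial
   coefficient alone and only the other one by induction; this is what keeps
   the bound linear in the size of the expression. *)
Lemma cat_bound (s1 s2 s m1 m2 a b k : nat) :
  s <= a * b -> m1 <= m2 -> a <= 'C(m1, k) ->
  (INR b * gain m2 <= INR s2 * 2 ^ m2)%R ->
  (INR s * gain (m1 + m2) <= INR (s1 + s2).+1 * 2 ^ (m1 + m2))%R.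
Proof.
move=> /leP/le_INR s_le m12 /leP/le_INR a_le b_bound.
have gain_le := gain_add m12.
have bin_le := bin_sqrt_le m1 k.
rewrite (mult_INR a b : INR (a * b) = _) in s_le.
have sq_ge0 := sqrt_pos (INR m1.+1).
have [g_gt0 g2_gt0] := (gain_gt0 (m1 + m2), gain_gt0 m2).
have pow_gt0 (m : nat) : (0 < 2 ^ m)%R by apply: pow_lt; lra.
have a_sqrt : (INR a * sqrt (INR m1.+1) <= 2 ^ m1)%R.
  by apply: Rle_trans bin_le; apply: Rmult_le_compat_r.
have [a_ge0 b_ge0] := (pos_INR a, pos_INR b).
apply: (Rle_trans _ (INR a * INR b * (sqrt (INR m1.+1) * gain m2))).
  by apply: Rmult_le_compat => //; [exact: pos_INR | lra].
apply: (Rle_trans _ (2 ^ m1 * (INR s2 * 2 ^ m2))).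
  rewrite (_ : (_ * _)%R = (INR a * sqrt (INR m1.+1) * (INR b * gain m2))%R);
    last by ring.
  by apply: Rmult_le_compat => //; apply: Rmult_le_pos; lra.
rewrite (pow_add 2 m1 m2 : 2 ^ (m1 + m2) = _)%R.
rewrite (_ : (2 ^ m1 * (INR s2 * 2 ^ m2) = INR s2 * (2 ^ m1 * 2 ^ m2))%R); last by ring.
apply: Rmult_le_compat_r; first by apply: Rlt_le; apply: Rmult_lt_0_compat.
by apply/le_INR/leP; lia.
Qed.

(** Lists of distinct words stand in for the cardinality of the language. The vector [(m, k)] varies
    in the induction because each factor of a concatenation has its own. *)
Lemma parikh_bound (r : regex bool) (m k : nat) (ws : seq (seq bool)) :
  parikh (regex_lang r) m k -> uniq ws -> (forall w, w \in ws -> regex_lang r w) ->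
  (INR (size ws) * gain m <= INR (rpn_size r) * 2 ^ m)%R.
Proof.
elim: r m k ws => [||a|r1 IH1 r2 IH2|r1 IH1 r2 IH2|r1 _] m k ws r_parikh ws_uniq ws_in.
- case: ws ws_in {ws_uniq} => [_|w ws /(_ w (mem_head _ _)) //].
  by rewrite Rmult_0_l; apply: Rmult_le_pos; [exact: pos_INR | apply: pow_le; lra].
- have [/esym m0 _] := r_parikh [::] erefl.
  apply: (@short_parikh_bound _ _ _ k); rewrite ?m0 // => w.
  by move/ws_in/r_parikh; rewrite m0.
- have [/esym m1 _] := r_parikh [:: a] erefl.
  apply: (@short_parikh_bound _ _ _ k); rewrite ?m1 // => w.
  by move/ws_in/r_parikh; rewrite m1.
- have [ws1 [ws2 [ws_perm ws1_in ws2_in]]] : exists ws1 ws2 : seq (seq bool),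
      [/\ perm_eq ws (ws1 ++ ws2), forall w, w \in ws1 -> regex_lang r1 w
        & forall w, w \in ws2 -> regex_lang r2 w] := split_or ws_in.
  have size_ws : size ws = size ws1 + size ws2.
    by rewrite (perm_size ws_perm) size_cat.
  move: ws_uniq; rewrite (perm_uniq ws_perm) cat_uniq => /and3P[ws1_uniq _ ws2_uniq].
  have := IH1 m k ws1 (fun w H => r_parikh w (or_introl H)) ws1_uniq ws1_in.
  have := IH2 m k ws2 (fun w H => r_parikh w (or_intror H)) ws2_uniq ws2_in.
  have pow_gt0 : (0 < 2 ^ m)%R by apply: pow_lt; lra.
  rewrite size_ws plus_INR -[rpn_size (RPlus r1 r2)]/(rpn_size r1 + rpn_size r2).+1.
  rewrite S_INR plus_INR.
  lra.
- case: ws ws_in ws_uniq => [_ _|w0 ws']; last set ws := _ :: ws'.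
    by rewrite Rmult_0_l; apply: Rmult_le_pos; [exact: pos_INR | apply: pow_le; lra].
  move=> ws_in ws_uniq; have [u0 [v0 [_ [r1u0 r2v0]]]] := ws_in w0 (mem_head _ _).
  have cat_parikh u v : regex_lang r1 u -> regex_lang r2 v ->
      size u + size v = m /\ count_mem true u + count_mem true v = k.
    by move=> r1u r2v; rewrite -size_cat -count_cat; apply: r_parikh; exists u, v.
  (* With one word of the other factor held fixed, subtraction forces all words of this factor to
     share length and number of ones. *)
  have parikh1 : parikh (regex_lang r1) (size u0) (count_mem true u0).
    move=> u r1u; have := cat_parikh _ _ r1u r2v0; have := cat_parikh _ _ r1u0 r2v0.
    by rewrite /slice; lia.
  have parikh2 : parikh (regex_lang r2) (size v0) (count_mem true v0).
    move=> v r2v; have := cat_parikh _ _ r1u0 r2v; have := cat_parikh _ _ r1u0 r2v0.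
    by rewrite /slice; lia.
  have [<- _] := cat_parikh _ _ r1u0 r2v0.
  have size_ws := size_le_take_drop (size u0) ws_uniq.
  move: size_ws; set us := undup (map (take _) _).
  set vs := undup (map (drop _) _) => size_ws.
  have split_ws w : w \in ws ->
      regex_lang r1 (take (size u0) w) /\ regex_lang r2 (drop (size u0) w).
    case/ws_in=> u [v [-> [r1u r2v]]].
    by have [<- _] := parikh1 u r1u; rewrite take_size_cat // drop_size_cat.
  have us_in w : w \in us -> regex_lang r1 w.
    by rewrite mem_undup => /mapP[w' /split_ws[? _] ->].
  have vs_in w : w \in vs -> regex_lang r2 w.
    by rewrite mem_undup => /mapP[w' /split_ws[_ ?] ->].
  have [us_uniq vs_uniq] : uniq us /\ uniq vs by rewrite !undup_uniq.
  (* The factor with shorter words is counted by the binomial coefficient, the other one by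
     induction. *)
  have [uv|/ltnW vu] := leqP (size u0) (size v0).
    apply: cat_bound size_ws uv _ (IH2 _ _ _ parikh2 vs_uniq vs_in).
    by apply: size_count_le_bin us_uniq (fun w H => parikh1 w (us_in w H)).
  rewrite addnC -[rpn_size _]/(rpn_size r1 + rpn_size r2).+1 (addnC (rpn_size r1)).
  rewrite mulnC in size_ws.
  apply: cat_bound size_ws vu _ (IH1 _ _ _ parikh1 us_uniq us_in).
  by apply: size_count_le_bin vs_uniq (fun w H => parikh2 w (vs_in w H)).
(* A star contains the empty word, so inside a slice it contains nothing else. *)
- have [/esym m0 _] : size (Nil bool) = m /\ count_mem true (Nil bool) = k.
    by apply: r_parikh; exists [::]; split.
  apply: (@short_parikh_bound _ _ _ k); rewrite ?m0 // => w.
  by move/ws_in/r_parikh; rewrite m0.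
Qed.

(** * Existence of hard slices *)

(** Pigeonhole: the [n.+1] possible numbers of ones partition the cube. *)
Lemma exists_large_slice (n : nat) :
  exists2 k, k <= n & exists2 ws : seq (seq bool),
    uniq ws /\ (forall w, w \in ws -> slice n k w) & 2 ^ n <= n.+1 * size ws.
Proof.
pose slices (k : 'I_n.+1) := [pred t : n.-tuple bool | count_mem true t == k].
have [k k_large] : exists k, 2 ^ n <= n.+1 * #|slices k|.
  apply/existsP; apply: contraT; rewrite negb_exists => /forallP small.
  have count_lt (t : n.-tuple bool) : count_mem true t < n.+1.
    by rewrite ltnS -[leqRHS](size_tuple t) count_size.
  have : \sum_(k < n.+1) n.+1 * #|slices k| < \sum_(k < n.+1) 2 ^ n.
    have ltk k : n.+1 * #|slices k| < 2 ^ n by rewrite ltnNge small.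
    rewrite !big_ord_recl -addSn leq_add //.
    by apply: leq_sum => i _; apply: ltnW.
  rewrite -big_distrr /= sum_nat_const card_ord ltn_pmul2l //.
  rewrite -{1}card_bool -card_tuple -sum1_card.
  rewrite (partition_big (fun t => Ordinal (count_lt t)) predT) //=.
  rewrite [leqRHS](eq_bigr (fun k => #|slices k|)) ?ltnn // => k _.
  by rewrite sum1_card; apply: eq_card => t; rewrite !inE.
exists k; first by rewrite -ltnS.
exists (map val (enum (slices k))); last by rewrite size_map -cardE.
split; first by rewrite map_inj_uniq ?enum_uniq //; apply: val_inj.
by move=> w /mapP[t]; rewrite mem_enum => /eqP t_k ->; rewrite /slice size_tuple.
Qed.

(** Half of the exponent [ln (n + 1) ^ 2 / 8] dominates that of [superpoly_bound]; the other half
    absorbs the factor [n + 1] as soon as [ln (n + 1) >= 16]. *)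
Lemma superpoly_le_gain (n : nat) :
  (0 < n)%N -> (exp 16 <= INR n.+1)%R ->
  (superpoly_bound (1 / 16) n * INR n.+1 <= gain n)%R.
Proof.
move=> n_pos; have /ltP/lt_0_INR n_gt0 := n_pos; move=> n_large.
have nS : (INR n <= INR n.+1)%R by rewrite S_INR; lra.
rewrite -{1}[INR n.+1]exp_ln; last by lra.
rewrite /superpoly_bound /Rpower /gain -exp_plus; apply: exp_le_compat.
have ln_ge : (16 <= ln (INR n.+1))%R.
  by rewrite -[16%R]ln_exp; apply: ln_le_compat => //; apply: exp_pos.
have : (0 <= ln (INR n) <= ln (INR n.+1))%R.
  split; last exact: ln_le_compat.
  rewrite -ln_1; apply: ln_le_compat; first by lra.
  by have /ltP/(le_INR 1) := n_pos.
nra.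
Qed.

Lemma hard_slice (n : nat) :
  (0 < n)%N -> (exp 16 <= INR n.+1)%R ->
  exists2 k, k <= n & rpn_ge (slice n k) (superpoly_bound (1 / 16) n).
Proof.
move=> n_gt0 n_large; have [k k_le [ws [ws_uniq ws_in] ws_large]] := exists_large_slice n.
exists k => // r r_slice.
have r_parikh : parikh (regex_lang r) n k by move=> w /r_slice.
have := parikh_bound r_parikh ws_uniq (fun w H => (r_slice w).2 (ws_in w H)).
have := superpoly_le_gain n_gt0 n_large.
move: ws_large => /leP/le_INR; rewrite mult_INR.
have -> : INR (2 ^ n) = (2 ^ n)%R.
  by elim: (n) => //= m IHm; rewrite expnS mult_INR IHm.
have := gain_gt0 n; have := lt_0_INR n.+1 (PeanoNat.Nat.lt_0_succ n).
have : (0 < 2 ^ n)%R by apply: pow_lt; lra.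
move: (2 ^ n)%R (INR n.+1) (gain n) (INR (size ws)) (superpoly_bound _ _) => p q g s b.
move=> p_gt0 q_gt0 g_gt0 ps bg sg.
(* After scaling by [p * q], the chain is [b * q * p <= g * p <= q * s * g], and [s * g] is bounded
   by [p] times the size of [r]. *)
apply: (Rmult_le_reg_r (p * q)); first by nra.
apply: (Rle_trans _ (p * g)); first by nra.
apply: (Rle_trans _ (q * (s * g))); nra.
Qed.

(** * Erasing and forbidding letters in expressions *)

Lemma InE (T : eqType) (x : T) (s : seq T) : List.In x s <-> x \in s.
Proof.
elim: s => //= y s ->; rewrite inE eq_sym; split=> [[->|->]|/predU1P[->|]].
- by rewrite eqxx.
- by rewrite orbT.
- by left.
- by right.
Qed.

(** Letters outside [p] are forbidden, and [f] renames a letter or erases it. Only leaves change, so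
    the syntax tree keeps its shape. *)
Fixpoint letter_image (A B : Type) (p : pred A) (f : A -> option B) (r : regex A) :
    regex B :=
  match r with
  | REmpty => REmpty
  | REps => REps
  | RLit a => if p a then (if f a is Some b then RLit b else REps) else REmpty
  | RPlus r1 r2 => RPlus (letter_image p f r1) (letter_image p f r2)
  | RCat r1 r2 => RCat (letter_image p f r1) (letter_image p f r2)
  | RStar r1 => RStar (letter_image p f r1)
  end.

Lemma letter_image_size (A B : Type) (p : pred A) (f : A -> option B) (r : regex A) :
  rpn_size (letter_image p f r) = rpn_size r.
Proof.
elim: r => //= [a|r1 -> r2 ->|r1 -> r2 ->|r1 ->] //.
by case: (p a) => //; case: (f a).
Qed.

Lemma letter_image_lang (A B : eqType) (p : pred A) (f : A -> option B) (r : regex A)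
    (w : seq B) :
  regex_lang (letter_image p f r) w <->
  exists v, [/\ regex_lang r v, all p v & w = pmap f v].
Proof.
elim: r w => [||a|r1 IH1 r2 IH2|r1 IH1 r2 IH2|r1 IH1] w /=.
- by split=> // -[v []].
- by split=> [->|[v [-> _ ->]]] //; exists [::].
- have [pa|pa] := boolP (p a); last by split=> // -[v [->]]; rewrite /= (negPf pa).
  split=> [w_a|[v [-> _ ->]]]; last by rewrite /=; case: (f a).
  by exists [:: a]; rewrite /= pa; split=> //; case: (f a) w_a => [b|] ->.
- split=> [[/IH1|/IH2] [v [r_v pv ->]]|[v [[r_v|r_v] pv ->]]].
  + by exists v; split=> //; left.
  + by exists v; split=> //; right.
  + by left; apply/IH1; exists v.
  + by right; apply/IH2; exists v.
- split=> [[_ [_ [-> [/IH1[u [r_u pu ->]] /IH2[v [r_v pv ->]]]]]]|].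
    exists (u ++ v); rewrite all_cat pu pmap_cat; split=> //.
    by exists u, v.
  case=> _ [[u [v [-> [r_u r_v]]]] + ->]; rewrite all_cat => /andP[pu pv].
  exists (pmap f u), (pmap f v); rewrite pmap_cat; split=> //.
  by split; [apply/IH1; exists u | apply/IH2; exists v].
split=> [[ws [-> ws_in]]|[_ [[vs [-> vs_in]] + ->]]].
  elim: ws ws_in => [|w' ws IHws] ws_in; first by exists [::]; split=> //; exists [::].
  have /IH1[v [r_v pv w'E]] := ws_in _ (or_introl erefl).
  have [_ [[vs [-> vs_in]] pvs wsE]] := IHws (fun u H => ws_in u (or_intror H)).
  exists (v ++ flatten vs); split; last by rewrite pmap_cat w'E -wsE.
    by exists (v :: vs); split=> // u [<-|/vs_in].
  by rewrite all_cat pv.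
move=> /allP pvs; exists (map (pmap f) vs); split.
  by elim: vs {vs_in pvs} => //= v vs <-; rewrite pmap_cat.
move=> u /InE/mapP[v v_vs ->]; apply/IH1; exists v; split=> //; first exact/vs_in/InE.
by apply/allP => a a_v; apply: pvs; apply/flattenP; exists v.
Qed.

(** Hardness is pulled back: an expression for [L] yields one of the same size for its image
    [L']. *)
Lemma rpn_ge_letter_image (A B : eqType) (p : pred A) (f : A -> option B) (L : lang A)
    (L' : lang B) (b : R) :
  (forall w, L' w <-> exists v, [/\ L v, all p v & w = pmap f v]) ->
  rpn_ge L' b -> rpn_ge L b.
Proof.
move=> L'E L'_ge r rL; rewrite -(letter_image_size p f); apply: L'_ge => w.
rewrite letter_image_lang L'E.
by split=> -[v [/rL Lv pv ->]]; exists v; split.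
Qed.

(** * Finite languages and powers of expressions *)

Fixpoint star_free (A : Type) (r : regex A) : bool :=
  match r with
  | REmpty | REps | RLit _ => true
  | RPlus r1 r2 | RCat r1 r2 => star_free r1 && star_free r2
  | RStar _ => false
  end.

Lemma star_free_finite (A : eqType) (r : regex A) :
  star_free r -> finite_lang (regex_lang r).
Proof.
suff mem_finite : star_free r ->
    exists ws : seq (seq A), forall w, regex_lang r w <-> w \in ws.
  by case/mem_finite=> ws wsE; exists ws => w; rewrite InE.
elim: r => [||a|r1 IH1 r2 IH2|r1 IH1 r2 IH2|] //=.
- by exists [::].
- by exists [:: [::]] => w; rewrite inE; split=> [->|/eqP].
- by exists [:: [:: a]] => w; rewrite inE; split=> [->|/eqP].
- case/andP=> /IH1[ws1 E1] /IH2[ws2 E2]; exists (ws1 ++ ws2) => w.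
  by rewrite mem_cat E1 E2; split=> /orP.
case/andP=> /IH1[ws1 E1] /IH2[ws2 E2]; exists [seq u ++ v | u <- ws1, v <- ws2] => w.
split=> [[u [v [-> [/E1 u1 /E2 v2]]]]|/allpairsP[[u v] [/E1 u1 /E2 v2 ->]]].
  exact: allpairs_f.
by exists u, v.
Qed.

Fixpoint rpow (A : Type) (r : regex A) (n : nat) : regex A :=
  if n is n'.+1 then RCat r (rpow r n') else REps.

Lemma rpow_size (A : Type) (r : regex A) (n : nat) :
  rpn_size (rpow r n) = (n * (rpn_size r).+1).+1.
Proof. by elim: n => //= n ->; lia. Qed.

Lemma rpow_star_free (A : Type) (r : regex A) (n : nat) :
  star_free r -> star_free (rpow r n).
Proof. by move=> r_free; elim: n => //= n ->; rewrite r_free. Qed.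

(** Presenting the language of [r] as the range of [g] replaces factorisations by lists of indices;
    for [token] these lists are the Boolean words themselves. *)
Lemma rpow_lang (A X : Type) (g : X -> seq A) (r : regex A) (n : nat) (w : seq A) :
  (forall u, regex_lang r u <-> exists x, u = g x) ->
  regex_lang (rpow r n) w <-> exists2 s, size s = n & w = flatten (map g s).
Proof.
move=> rE; elim: n w => [|n IHn] w /=.
  by split=> [->|[s /size0nil-> ->]] //; exists [::].
split=> [[_ [_ [-> [/rE[x ->] /IHn[s s_n ->]]]]]|[[//|x s] [s_n] ->]].
  by exists (x :: s); rewrite /= ?s_n.
exists (g x), (flatten (map g s)); split=> //.
by split; [apply/rE; exists x | apply/IHn; exists s].
Qed.

Lemma rpow_lit_lang (A : Type) (a : A) (n : nat) (w : seq A) :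
  regex_lang (rpow (RLit a) n) w <-> w = nseq n a.
Proof.
elim: n w => //= n IHn w; split=> [[_ [_ [-> [-> /IHn->]]]]//|->].
by exists [:: a], (nseq n a); split=> //; split=> //; apply/IHn.
Qed.

(** * Interleavings and letter counts *)

Section Shuffle.

Variable A : eqType.
Implicit Types u v w : seq A.

(** Membership in a slice depends only on letter counts, so this is enough to show that shuffles of
    the unary words lie in the slice. *)
Lemma shuffle_words_perm v w u : shuffle_words v w u -> perm_eq u (v ++ w).
Proof.
case=> vs [ws [vs_ws [<- [<- ->]]]].
elim: vs ws vs_ws => [|v' vs IHvs] [|w' ws] //= [/IHvs vs_perm].
by rewrite -!catA perm_cat2l perm_sym perm_catCA perm_cat2l perm_sym.
Qed.

Lemma shuffle_words_consl (a : A) v w u :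
  shuffle_words v w u -> shuffle_words (a :: v) w (a :: u).
Proof.
case=> vs [ws [vs_ws [<- [<- ->]]]].
by exists ([:: a] :: vs), ([::] :: ws); rewrite /= vs_ws.
Qed.

Lemma shuffle_words_consr (a : A) v w u :
  shuffle_words v w u -> shuffle_words v (a :: w) (a :: u).
Proof.
case=> vs [ws [vs_ws [<- [<- ->]]]].
by exists ([::] :: vs), ([:: a] :: ws); rewrite /= vs_ws.
Qed.

End Shuffle.

(** The word [s] is itself the schedule: [true] takes the next letter from the first word, [false]
    from the second. *)
Lemma shuffle_unary (A : eqType) (h : bool -> A) (s : seq bool) :
  shuffle_words (nseq (count_mem true s) (h true)) (nseq (count_mem false s) (h false))
    (map h s).
Proof.
elim: s => [|[] s IHs] /=; first by exists [::], [::].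
  exact: shuffle_words_consl.
exact: shuffle_words_consr.
Qed.

(* [inl (Some b)] are the letters of a Boolean word, written in the
   intersection as [0] and [1c], where [c = inl None] makes the length of the
   encoding reveal the number of ones; [inr b] are the letters of the unary
   words to be shuffled. *)
Notation alphabet := (option bool + bool)%type.

(** * The two finite languages and their images *)

Definition encode (b : bool) : seq (option bool) :=
  if b then [:: Some true; None] else [:: Some false].

Lemma encode_size (s : seq bool) :
  size (flatten (map encode s)) = size s + count_mem true s.
Proof. by elim: s => // -[] s /=; lia. Qed.

Lemma encodeK : cancel (fun s => flatten (map encode s)) (pmap (fun x => x)).
Proof. by elim=> // -[] s /= ->. Qed.

Definition token : regex alphabet :=
  RPlus (RLit (inl (Some false))) (RCat (RLit (inl (Some true))) (RLit (inl None))).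

Definition symbol : regex alphabet :=
  RPlus (RLit (inl (Some false))) (RPlus (RLit (inl (Some true))) (RLit (inl None))).

(** One pair of languages must be hard for both operations, so each is a union of an intersection
    gadget and a shuffle gadget over disjoint letters. *)
Definition tokens_or_unary (n k : nat) : regex alphabet :=
  RPlus (rpow token n) (rpow (RLit (inr true)) k).

Definition symbols_or_unary (n k : nat) : regex alphabet :=
  RPlus (rpow symbol (n + k)) (rpow (RLit (inr false)) (n - k)).

Lemma tokens_or_unary_lang (n k : nat) (w : seq alphabet) :
  regex_lang (tokens_or_unary n k) w <->
  (exists2 s, size s = n & w = map inl (flatten (map encode s))) \/ w = nseq k (inr true).
Proof.
rewrite -rpow_lit_lang /=; apply: or_iff_compat_r.
rewrite (@rpow_lang _ _ (fun b => map inl (encode b))) => [|u].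
  by split=> -[s s_n ->]; exists s; rewrite // map_flatten -map_comp.
split=> [[->|[_ [_ [-> [-> ->]]]]]|[[] ->]].
- by exists false.
- by exists true.
- by right; exists [:: inl (Some true)], [:: inl None].
- by left.
Qed.

Lemma symbols_or_unary_lang (n k : nat) (w : seq alphabet) :
  regex_lang (symbols_or_unary n k) w <->
  (exists2 t, size t = n + k & w = map inl t) \/ w = nseq (n - k) (inr false).
Proof.
rewrite -rpow_lit_lang /=; apply: or_iff_compat_r.
rewrite (@rpow_lang _ _ (fun x => [:: inl x])) => [|u].
  by split=> -[s s_n ->]; exists s; rewrite //; elim: (s) => //= x s' ->.
split=> [[->|[->|->]]|[[[]|] ->]].
- by exists (Some false).
- by exists (Some true).
- by exists None.
- by right; left.
- by left.
- by right; right.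
Qed.

Definition is_inl (a : alphabet) : bool := if a is inl _ then true else false.
(** The padding letter [inl None] has content [None], so it is erased without a case of its own. *)
Definition inl_part (a : alphabet) : option bool := if a is inl x then x else None.
Definition inr_part (a : alphabet) : option bool := if a is inr b then Some b else None.

Lemma all_is_inl (t : seq (option bool)) : all is_inl (map inl t).
Proof. by elim: t. Qed.

Lemma all_not_inl (t : seq (option bool)) :
  0 < size t -> ~~ all (predC is_inl) (map inl t).
Proof. by case: t. Qed.

Lemma pmap_inl_part (t : seq (option bool)) :
  pmap inl_part (map inl t) = pmap (fun x => x) t.
Proof. by elim: t => //= x t ->. Qed.

(** An encoding of [n] letters has length [n] plus its number of ones, so matching [n + k] symbols
    means having [k] ones. *)
Lemma slice_inter_image (n k : nat) (w : seq bool) : 0 < n ->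
  slice n k w <->
  exists v, [/\ lang_inter (regex_lang (tokens_or_unary n k))
                  (regex_lang (symbols_or_unary n k)) v,
                all is_inl v & w = pmap inl_part v].
Proof.
move=> n_gt0; split=> [[w_size w_count]|[v [[]]]].
  exists (map inl (flatten (map encode w))); split.
  - split; first by apply/tokens_or_unary_lang; left; exists w.
    apply/symbols_or_unary_lang; left; exists (flatten (map encode w)) => //.
    by rewrite encode_size w_size w_count.
  - exact: all_is_inl.
  by rewrite pmap_inl_part encodeK.
move=> /tokens_or_unary_lang + /symbols_or_unary_lang + + ->.
case=> [[s s_n ->]|->] [[t t_size]|].
- move/(congr1 size); rewrite !size_map encode_size s_n t_size => /addnI s_count _.
  by rewrite pmap_inl_part encodeK.
(* In the remaining cases a unary word free of letters [inr] would be empty, and the lengths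
   contradict [0 < n]. *)
- move=> vE; have := congr1 size vE; rewrite size_map encode_size size_nseq s_n => sizeE.
  by rewrite vE all_nseq /= orbF; lia.
- move/(congr1 size); rewrite size_map size_nseq t_size all_nseq /= orbF => sizeE.
  by lia.
move/(congr1 size); rewrite !size_nseq all_nseq /= orbF => sizeE.
by lia.
Qed.

(** As [0 < n], forbidding the letters [inl] leaves only the unary words, whose shuffles are the
    words with [k] ones and [n - k] zeros. *)
Lemma slice_shuffle_image (n k : nat) (w : seq bool) : 0 < n -> k <= n ->
  slice n k w <->
  exists v, [/\ shuffle (regex_lang (tokens_or_unary n k))
                  (regex_lang (symbols_or_unary n k)) v,
                all (predC is_inl) v & w = pmap inr_part v].
Proof.
move=> n_gt0 k_le; split=> [[w_size w_count]|].
  exists (map inr w); split; [|by elim: w {w_size w_count}|].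
    exists (nseq k (inr true)), (nseq (n - k) (inr false)).
    rewrite tokens_or_unary_lang symbols_or_unary_lang.
    split; [by right|split; [by right|]].
    have -> : n - k = count_mem false w.
      rewrite -w_size -w_count -(count_predC (pred1 true)) addKn.
      by apply: eq_count => -[].
    by rewrite -{1}w_count; apply: shuffle_unary.
  by elim: w {w_size w_count} => //= b w <-.
case=> v [[v1 [v2 [v1_in [v2_in /shuffle_words_perm v_perm]]]] + ->].
rewrite (perm_all _ v_perm) all_cat => /andP[v1_inr v2_inr].
have v1E : v1 = nseq k (inr true).
  case/tokens_or_unary_lang: v1_in => // -[s s_n v1E].
  by move: v1_inr; rewrite v1E (negPf (all_not_inl _)) // encode_size s_n ltn_addr.
have v2E : v2 = nseq (n - k) (inr false).
  case/symbols_or_unary_lang: v2_in => // -[t t_size v2E].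
  by move: v2_inr; rewrite v2E (negPf (all_not_inl _)) // t_size ltn_addr.
have : perm_eq (pmap inr_part v) (nseq k true ++ nseq (n - k) false).
  have -> : nseq k true ++ nseq (n - k) false = pmap inr_part (v1 ++ v2).
    rewrite v1E v2E pmap_cat; congr (_ ++ _).
      by elim: (k) => //= ? ->.
    by elim: (n - k) => //= ? ->.
  exact: perm_pmap.
move=> w_perm; split; first by rewrite (perm_size w_perm) size_cat !size_nseq subnKC.
by rewrite (permP w_perm) count_cat !count_nseq /= mul1n mul0n addn0.
Qed.

(** * Expressions for a fixed number of ones *)

Fixpoint exact_ones (k : nat) : regex bool :=
  let zeros := RStar (RLit false) in
  if k is k'.+1 then RCat zeros (RCat (RLit true) (exact_ones k')) else zeros.

Lemma exact_ones_size (k : nat) : rpn_size (exact_ones k) = k * 5 + 2.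
Proof. by elim: k => //= k ->; lia. Qed.

Lemma zeros_lang (w : seq bool) :
  regex_lang (RStar (RLit false)) w <-> count_mem true w = 0.
Proof.
split=> [[ws [-> ws_in]]|w_count].
  elim: ws ws_in => //= u ws IHws ws_in.
  rewrite count_cat (ws_in u (or_introl erefl)) /=.
  by apply: IHws => v v_in; apply: ws_in; right.
elim: w w_count => [|[] w IHw] //=; first by exists [::].
by case/IHw=> ws [-> ws_in]; exists ([:: false] :: ws); split=> // u [<-|/ws_in].
Qed.

Lemma exact_ones_lang (k : nat) (w : seq bool) :
  regex_lang (exact_ones k) w <-> count_mem true w = k.
Proof.
elim: k w => [|k IHk] w; first exact: zeros_lang.
split=> [[u [_ [-> [u_in [_ [v [-> [-> /IHk v_count]]]]]]]]|].
  by have u_count := (zeros_lang u).1 u_in; rewrite !count_cat u_count v_count.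
elim: w => // -[] w IHw /=.
  case=> /IHk w_in; exists [::], (true :: w); split=> //; split.
    by exists [::].
  by exists [:: true], w.
case/IHw=> u [v [-> [u_in v_in]]]; exists (false :: u), v; split=> //; split=> //.
by apply/zeros_lang; apply: (zeros_lang u).1 u_in.
Qed.

(** * Linear size bounds and assembly *)

Lemma linear_size (A : Type) (r : regex A) (c n : nat) :
  rpn_size r <= c * n -> (INR (rpn_size r) <= INR c * INR n)%R.
Proof. by move=> /leP/le_INR; rewrite mult_INR. Qed.

Lemma eventually_hard_slice :
  exists N, forall n, N <= n ->
    0 < n /\ exists2 k, k <= n & rpn_ge (slice n k) (superpoly_bound (1 / 16) n).
Proof.
have [N N_large] := INR_unbounded (exp 16).
exists N.+1 => n n_ge; have n_gt0 : 0 < n by apply: leq_trans n_ge.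
split=> //; apply: hard_slice => //.
have /leP/le_INR : N <= n.+1 by lia.
by lra.
Qed.

Theorem theorem5p5 :
  (exists (A : finType) (C c : R) (N : nat), (0 < c)%R /\
     forall n : nat, (N <= n)%N ->
       exists r1 r2 : regex A,
         finite_lang (regex_lang r1) /\ finite_lang (regex_lang r2) /\
         (INR (rpn_size r1) <= C * INR n)%R /\ (INR (rpn_size r2) <= C * INR n)%R /\
         rpn_ge (lang_inter (regex_lang r1) (regex_lang r2)) (superpoly_bound c n) /\
         rpn_ge (shuffle (regex_lang r1) (regex_lang r2)) (superpoly_bound c n))
  /\
  (exists (A : finType) (C c : R) (N : nat), (0 < c)%R /\
     forall n : nat, (N <= n)%N ->
       exists r : regex A,
         (INR (rpn_size r) <= C * INR n)%R /\
         rpn_ge (restrict_len (regex_lang r) n) (superpoly_bound c n)).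
Proof.
have [N hard] := eventually_hard_slice; split.
  (* The sizes are [6n + 2k + 3] and [8n + 4k + 3], both below [17n] because [k <= n] and
     [0 < n]. *)
  exists alphabet, (INR 17), (1 / 16)%R, N; split; first by lra.
  move=> n /hard[n_gt0 [k k_le k_hard]].
  exists (tokens_or_unary n k), (symbols_or_unary n k); do 5?split.
  - by apply: star_free_finite; rewrite /= !rpow_star_free.
  - by apply: star_free_finite; rewrite /= !rpow_star_free.
  - by apply: linear_size; rewrite /= !rpow_size /=; lia.
  - by apply: linear_size; rewrite /= !rpow_size /=; lia.
  - by apply: rpn_ge_letter_image k_hard => w; apply: slice_inter_image.
  - by apply: rpn_ge_letter_image k_hard => w; apply: slice_shuffle_image.
(* The size [5k + 2] is at most [7n]. *)
exists bool, (INR 7), (1 / 16)%R, N; split; first by lra.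
move=> n /hard[n_gt0 [k k_le k_hard]]; exists (exact_ones k); split.
  by apply: linear_size; rewrite exact_ones_size; lia.
move=> r rE; apply: k_hard => w; rewrite rE /restrict_len exact_ones_lang /slice.
by split=> -[].
Qed.
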